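(* Let $s$ and $v$ be positive integers and let $\{\varphi_{i,j}\}_{i=1,\dots,v;\ j=1,\dots,s+1}$ be an equiangular tight frame (ETF) for a $d$-dimensional Hilbert space $\mathbb{H}$ (over $\mathbb{R}$ or $\mathbb{C}$) such that $\{\varphi_{i,j}\}_{j=1}^{s+1}$ is a regular simplex for each $i=1,\dots,v$. Then $\{\mathcal{U}_i\}_{i=1}^{v}$ is an equichordal tight fusion frame (ECTFF) for $\mathbb{H}$, where $\mathcal{U}_i:=\operatorname{span}\{\varphi_{i,j}\}_{j=1}^{s+1}$.
   Context: A finite sequence of nonzero vectors $\{\varphi_l\}$ in $\mathbb{H}$ is an ETF for $\mathbb{H}$ if all vectors have equal norm, $|\langle\varphi_l,\varphi_{l'}\rangle|$ is constant over all $l\neq l'$, and there is $a>0$ such that $\sum_{l}\langle\varphi_l,y\rangle\varphi_l=ay$ for all $y\in\mathbb{H}$ (inner products are conjugate-linear in the first argument). A regular $s$-simplex is a sequence of $s+1$ vectors that is an ETF for its span, where this span has dimension $s$. A sequence $\{\mathcal{U}_i\}_{i=1}^v$ of subspaces of $\mathbb{H}$, all of the same dimension, is a tight fusion frame for $\mathbb{H}$ if there is $a>0$ such that $\sum_{i=1}^v\mathbf{P}_i=a\mathbf{I}$, where $\mathbf{P}_i$ is the orthogonal projection operator onto $\mathcal{U}_i$. It is an ECTFF for $\mathbb{H}$ if in addition $\operatorname{Tr}(\mathbf{P}_i\mathbf{P}_{i'})$ is constant over all $i\neq i'$. *)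

(* Defs.v *)
From HB Require Import structures.
From mathcomp Require Import all_boot all_order all_algebra.
From mathcomp Require Export sesquilinear reals complex.

Set Implicit Arguments.
Unset Strict Implicit.
Unset Printing Implicit Defensive.

Import Order.TTheory GRing.Theory Num.Theory.
Local Open Scope ring_scope.

(* The scalars are an ordered/normed field [F] with an involution [theta]; the
   theorem is about [theta = idfun] over the reals and complex conjugation over
   [R[i]].  A finite-dimensional Hilbert space is a [vectType] with a
   positive-definite Hermitian form.  In [R[i]], [0 < a] says that [a] is real
   and positive, and [`|z|] is the modulus. *)
Section Frames.

Variables (F : numFieldType) (theta : {rmorphism F -> F}) (H : vectType F).
Variable dot : {dot H for theta}.

(* [dot] is linear in its first argument, whereas inner products are
   conjugate-linear in the first argument here. *)
Definition inner (x y : H) : F := dot y x.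

(* Equality of norms is expressed by equality of the squares [inner x x]. *)
Definition is_ETF (I : finType) (phi : I -> H) (V : {vspace H}) : Prop :=
  [/\ forall l, phi l \in V,
      forall l, phi l != 0,
      forall l l', inner (phi l) (phi l) = inner (phi l') (phi l'),
      exists c : F, forall l l', l != l' -> `|inner (phi l) (phi l')| = c
    & exists2 a : F, 0 < a &
        forall y, y \in V -> \sum_l inner (phi l) y *: phi l = a *: y].

Definition is_regular_simplex (s : nat) (phi : 'I_s.+1 -> H) : Prop :=
  is_ETF phi <<codom phi>>%VS /\ \dim <<codom phi>>%VS = s.

(* [orthov dot U] is the orthogonal complement of [U]; [daddv_pi U W] projects
   onto [U] along [W]. *)
Definition orthoproj (U : {vspace H}) : 'End(H) := daddv_pi U (orthov dot U).

(* The choice of basis is immaterial. *)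
Definition lfun_trace (f : 'End(H)) : F :=
  \tr (passmx.mxof (vbasis {:H}) (vbasis {:H}) f).

Definition is_tight_fusion_frame (v : nat) (U : 'I_v -> {vspace H}) : Prop :=
  (forall i i', \dim (U i) = \dim (U i')) /\
  (exists2 a : F, 0 < a & \sum_i orthoproj (U i) = a *: \1%VF).

Definition is_ECTFF (v : nat) (U : 'I_v -> {vspace H}) : Prop :=
  is_tight_fusion_frame U /\
  (exists c : F, forall i i', i != i' ->
     lfun_trace (orthoproj (U i) \o orthoproj (U i'))%VF = c).

End Frames.

(* Main.v *)
From HB Require Import structures.
Require Import Defs.
From mathcomp Require Import all_boot all_order all_algebra.
From mathcomp Require Import sesquilinear reals complex ring.
Import Order.TTheory GRing.Theory Num.Theory.
Local Open Scope ring_scope.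
Local Open Scope complex_scope.

(** Let n be the common squared norm of the ETF vectors and phi_1, ..., phi_m
    (here m = s + 1) one of the simplices, with span U of dimension s.  On U
    the frame operator y |-> sum_l <phi_l, y> phi_l is a scalar a', and it
    vanishes on the orthogonal complement of U, so it equals a' P where P is
    the orthogonal projection onto U ([orthoproj_frame]).  Comparing traces
    gives a' s = m n ([frame_const_dim]): the scalar a' is thus the same for
    every simplex.

    Both claims follow from this uniformity.  The sum of the projections P_i is
    1 / a' times the frame operator of the whole ETF, which is scalar.  And
    Tr (P_i P_i') is 1 / a'^2 times the sum of the m^2 numbers
    |<phi_{i,j}, phi_{i',j'}>|^2 ([lfun_trace_comp_frame]), each equal to the
    square of the constant angle of the ETF as soon as i <> i'.

    All traces are evaluated by writing an operator as a sum of rank-one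
    operators ([lfun_trace_rank1_sum]).  The identity z * theta z = |z|^2 holds
    for the identity on the reals and for complex conjugation, so assuming it
    treats both cases at once. *)

Set Implicit Arguments.
Unset Strict Implicit.
Unset Printing Implicit Defensive.

(** The rank-one operator y |-> f y *: w has trace f w, because expanding w in
    the basis b gives sum_k f b_k * coord b k w, the sum of its diagonal
    entries. *)
Lemma lfun_trace_rank1_sum (F : numFieldType) (H : vectType F) (I : finType)
    (f : I -> H -> F) (w : I -> H) (g : 'End(H)) :
  (forall i, scalar (f i)) -> (forall y, g y = \sum_i f i y *: w i) ->
  lfun_trace g = \sum_i f i (w i).
Proof.
move=> f_lin gE.
pose fl i : {scalar H} :=
  HB.pack (f i) (GRing.isLinear.Build _ _ _ _ (f i) (f_lin i)).
set b := vbasis {:H}.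
have entry k : passmx.mxof b b g k k = \sum_i fl i b`_k * coord b k (w i).
  rewrite !mxE /= passmx.vecof_delta gE linear_sum /=.
  by apply: eq_bigr => i _; rewrite linearZ_LR.
rewrite /lfun_trace /mxtrace (eq_bigr _ (fun k _ => entry k)) exchange_big /=.
apply: eq_bigr => i _; rewrite -[f i (w i)]/(fl i (w i)).
rewrite {2}(coord_vbasis (memvf (w i))) linear_sum.
by apply: eq_bigr => k _; rewrite linearZ_LR mulrC.
Qed.

Section FrameProjections.

Variables (F : numFieldType) (theta : {rmorphism F -> F}) (H : vectType F).
Variable dot : {dot H for theta}.
Hypothesis theta_norm : forall z, z * theta z = `|z| ^+ 2.

Let innerC (x y : H) : inner dot x y = theta (inner dot y x).
Proof. by rewrite /inner (hermC dot) expr0 mul1r. Qed.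

Let inner_scalar (x : H) : scalar (inner dot x).
Proof. by move=> a y z; rewrite /inner linearPl. Qed.

Let theta_pos (a : F) : 0 < a -> theta a = a.
Proof.
move=> a_gt0; apply: (mulfI (lt0r_neq0 a_gt0)).
by rewrite theta_norm gtr0_norm.
Qed.

Lemma capv_orthov (U : {vspace H}) : (U :&: orthov dot U = 0)%VS.
Proof.
apply/eqP; rewrite -subv0; apply/subvP => u; rewrite memv_cap memv0.
case/andP=> uU /mem_orthovP /(_ u uU) uu0.
by apply: contraT => /(neq0_dnorm_gt0 (s := dot)); rewrite uu0 ltxx.
Qed.

(** [daddv_pi] is characterized only on the sum of U and its orthogonal
    complement; the decomposition y = x + (y - x) places y in that sum. *)
Lemma orthoproj_decomp (U : {vspace H}) (x y : H) :
  x \in U -> (forall u, u \in U -> inner dot u (y - x) = 0) ->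
  orthoproj dot U y = x.
Proof.
move=> xU yx_orth; rewrite -[y in LHS](subrK x) addrC linearD /=.
rewrite /orthoproj daddv_pi_id ?capv_orthov //.
have yxU : y - x \in orthov dot U by apply/mem_orthovP.
suff -> : daddv_pi U (orthov dot U) (y - x) = 0 by rewrite addr0.
have /= := daddv_pi_add (capv_orthov U) (subvP (addvSr U _) _ yxU).
rewrite (daddv_pi_id _ yxU) 1?capvC ?capv_orthov //.
by move/(canRL (addrK _)); rewrite subrr.
Qed.

Lemma orthoproj_id (U : {vspace H}) (u : H) : u \in U -> orthoproj dot U u = u.
Proof. by move=> uU; apply: daddv_pi_id => //; apply: capv_orthov. Qed.

(** In a basis of U, a projection onto U is the sum of the rank-one operators
    y |-> coord k (P y) *: b_k, each of trace 1 since P fixes b_k. *)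
Lemma lfun_trace_orthoproj (U : {vspace H}) :
  lfun_trace (orthoproj dot U) = (\dim U)%:R.
Proof.
rewrite (lfun_trace_rank1_sum
  (f := fun k y => coord (vbasis U) k (orthoproj dot U y))
  (w := fun k => (vbasis U)`_k)); first last.
- by move=> y; apply: coord_vbasis; apply: memv_pi.
- by move=> k a y z; rewrite linearP /= coord_is_scalar.
rewrite -[\dim U in RHS]card_ord -sum1_card natr_sum; apply: eq_bigr => k _.
have bU : (vbasis U)`_k \in U by apply: vbasis_mem; rewrite mem_nth ?size_tuple.
by rewrite orthoproj_id // coord_free ?eqxx // (basis_free (vbasisP U)).
Qed.

(** The residue y - x is orthogonal to every u in U: expanding u by the frame
    identity, <u, y> becomes a^-1 sum_l <u, phi_l> <phi_l, y>, which is <u, x>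
    for the x claimed to be the projection. *)
Lemma orthoproj_frame (I : finType) (phi : I -> H) (U : {vspace H}) (a : F) :
  (forall l, phi l \in U) -> 0 < a ->
  (forall y, y \in U -> \sum_l inner dot (phi l) y *: phi l = a *: y) ->
  forall y, orthoproj dot U y = a^-1 *: \sum_l inner dot (phi l) y *: phi l.
Proof.
move=> phiU a_gt0 frame y; have a_neq0 := lt0r_neq0 a_gt0.
apply: orthoproj_decomp => [|u uU].
  by apply/memvZ/memv_suml => l _; apply: memvZ.
rewrite /inner linearBl /=.
have {1}-> : u = a^-1 *: \sum_l inner dot (phi l) u *: phi l.
  by rewrite frame // scalerA mulVf ?scale1r.
rewrite linearZl_LR linearZr_LR /= linear_sumlz linear_sumr /=.
rewrite fmorphV theta_pos // -mulrBr -sumrB big1 ?mulr0 // => l _.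
rewrite linearZl_LR linearZr_LR /= -[theta _]innerC.
by rewrite /inner mulrC subrr.
Qed.

(** Both sides are the trace of the frame operator a P: the left one since P has
    trace dim U, the right one since each y |-> <phi_l, y> phi_l has trace
    <phi_l, phi_l>. *)
Lemma frame_const_dim (I : finType) (phi : I -> H) (U : {vspace H}) (a : F) :
  (forall l, phi l \in U) -> 0 < a ->
  (forall y, y \in U -> \sum_l inner dot (phi l) y *: phi l = a *: y) ->
  a * (\dim U)%:R = \sum_l inner dot (phi l) (phi l).
Proof.
move=> phiU a_gt0 frame; rewrite -lfun_trace_orthoproj.
rewrite (lfun_trace_rank1_sum (f := fun l => inner dot (phi l))
  (w := fun l => a^-1 *: phi l)) => [|//|y].
  rewrite mulr_sumr; apply: eq_bigr => l _.
  by rewrite /inner linearZl_LR /= mulVKf // lt0r_neq0.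
rewrite (orthoproj_frame phiU a_gt0 frame) scaler_sumr.
by apply: eq_bigr => l _; rewrite !scalerA mulrC.
Qed.

(** Eliminates the unknown frame constant, so that it can be compared from one
    frame to another. *)
Lemma orthoproj_ETF (I : finType) (phi : I -> H) (U : {vspace H}) :
  is_ETF dot phi U -> (0 < \dim U)%N -> forall y,
  orthoproj dot U y =
    ((\dim U)%:R / \sum_l inner dot (phi l) (phi l)) *:
      \sum_l inner dot (phi l) y *: phi l.
Proof.
case=> phiU _ _ _ [a a_gt0 frame] dimU y.
rewrite -(frame_const_dim phiU a_gt0 frame) (orthoproj_frame phiU a_gt0 frame).
by rewrite invfM mulrCA mulfV ?mulr1 // pnatr_eq0 -lt0n.
Qed.

(** The composite is the sum over (i, j) of the rank-one operators
    y |-> <psi_j, y> <phi_i, psi_j> phi_i, whose traces are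
    <phi_i, psi_j> <psi_j, phi_i> = |<phi_i, psi_j>|^2, all scaled by b c. *)
Lemma lfun_trace_comp_frame (I J : finType) (phi : I -> H) (psi : J -> H)
    (b c : F) (P Q : 'End(H)) :
  (forall y, P y = b *: \sum_i inner dot (phi i) y *: phi i) ->
  (forall y, Q y = c *: \sum_j inner dot (psi j) y *: psi j) ->
  lfun_trace (P \o Q)%VF =
    b * c * \sum_i \sum_j `|inner dot (phi i) (psi j)| ^+ 2.
Proof.
move=> PE QE; rewrite pair_big /=.
rewrite (lfun_trace_rank1_sum
  (f := fun p : I * J => inner dot (psi p.2))
  (w := fun p => (b * c * inner dot (phi p.1) (psi p.2)) *: phi p.1)) => [|//|y].
  rewrite mulr_sumr; apply: eq_bigr => -[i j] _ /=.
  rewrite {1}/inner linearZl_LR /= -/(inner dot (psi j) (phi i)).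
  by rewrite [inner dot (psi j) _]innerC -(mulrA (b * c)) theta_norm.
rewrite lfunE /= PE QE -(pair_bigA _ (fun i j => inner dot (psi j) y *:
  ((b * c * inner dot (phi i) (psi j)) *: phi i))) /=.
rewrite scaler_sumr; apply: eq_bigr => i _.
rewrite {1}/inner linearZl_LR linear_sumlz /= mulr_sumr scaler_suml scaler_sumr.
apply: eq_bigr => j _; rewrite linearZl_LR /= -!/(inner _ _ _) !scalerA.
by congr (_ *: _); ring.
Qed.

(** Each simplex has s + 1 vectors of the same squared norm n and a span of
    dimension s, so every projection is its frame operator scaled by the same
    factor b; tightness and the equality of traces are then inherited from the
    ETF. *)
Lemma ETF_of_simplices_ECTFF (s v : nat) (phi : 'I_v -> 'I_s.+1 -> H) :
  (0 < s)%N -> (0 < v)%N ->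
  is_ETF dot (fun p : 'I_v * 'I_s.+1 => phi p.1 p.2) {:H} ->
  (forall i, is_regular_simplex dot (phi i)) ->
  is_ECTFF dot (fun i => <<codom (phi i)>>%VS).
Proof.
move=> s_gt0 v_gt0 [_ phi_neq0 phi_norm [c phi_ang] [a a_gt0 frame]] simplex.
pose n := inner dot (phi (Ordinal v_gt0) ord0) (phi (Ordinal v_gt0) ord0).
have n_gt0 : 0 < n.
  exact: neq0_dnorm_gt0 (phi_neq0 (Ordinal v_gt0, ord0)).
(* The inverse of the frame constant shared by all the simplices. *)
pose b : F := s%:R / (n *+ s.+1).
have b_gt0 : 0 < b by rewrite divr_gt0 ?ltr0n // pmulrn_lgt0.
have projE i y : orthoproj dot <<codom (phi i)>>%VS y =
    b *: \sum_j inner dot (phi i j) y *: phi i j.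
  have [etf dimE] := simplex i.
  rewrite (orthoproj_ETF etf) ?dimE // /b; congr (_ / _ *: _).
  rewrite (eq_bigr (fun=> n)) ?sumr_const ?card_ord // => j _.
  exact: (phi_norm (i, j) (Ordinal v_gt0, ord0)).
split; [split|].
- by move=> i i'; rewrite (simplex i).2 (simplex i').2.
- exists (b * a); first exact: mulr_gt0.
  apply/lfunP => y; rewrite sum_lfunE (eq_bigr _ (fun i _ => projE i y)).
  rewrite -scaler_sumr pair_big /= frame ?memvf //.
  by rewrite !lfunE /= lfunE scalerA.
exists (b * b * (c ^+ 2 *+ s.+1 *+ s.+1)) => i i' i_neq.
rewrite (lfun_trace_comp_frame (projE i) (projE i')).
congr (_ * _); rewrite (eq_bigr (fun=> c ^+ 2 *+ s.+1)).
  by rewrite sumr_const card_ord.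
move=> j _; rewrite (eq_bigr (fun=> c ^+ 2)) ?sumr_const ?card_ord // => j' _.
by rewrite (phi_ang (i, j) (i', j')) // xpair_eqE negb_and i_neq.
Qed.

End FrameProjections.

Theorem theorem6p2 (R : realType) (s v d : nat) (hs : (0 < s)%N) (hv : (0 < v)%N) :
  (forall (H : vectType R) (dot : {dot H for idfun})
     (phi : 'I_v -> 'I_s.+1 -> H),
     \dim {:H} = d ->
     is_ETF dot (fun p : 'I_v * 'I_s.+1 => phi p.1 p.2) {:H} ->
     (forall i : 'I_v, is_regular_simplex dot (phi i)) ->
     is_ECTFF dot (fun i : 'I_v => <<codom (phi i)>>%VS))
  /\
  (forall (H : vectType R[i]) (dot : {dot H for Num.conj})
     (phi : 'I_v -> 'I_s.+1 -> H),
     \dim {:H} = d ->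
     is_ETF dot (fun p : 'I_v * 'I_s.+1 => phi p.1 p.2) {:H} ->
     (forall i : 'I_v, is_regular_simplex dot (phi i)) ->
     is_ECTFF dot (fun i : 'I_v => <<codom (phi i)>>%VS)).
Proof.
split=> H dot phi _ etf simplex.
  apply: ETF_of_simplices_ECTFF => // z /=.
  by rewrite real_normK ?num_real // expr2.
by apply: ETF_of_simplices_ECTFF => // z; rewrite normCK.
Qed.
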